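(* Let $(X,d_0)$ and $(Y,d_1)$ be unbounded metric spaces, $h:X\to Y$ a coarse proximity map, and $(\mathbf{B}X,\boldsymbol{\delta}_0)$, $(\mathbf{B}Y,\boldsymbol{\delta}_1)$ the corresponding proximity spaces at infinity. Then the map $\mathbf{B}h:\mathbf{B}X\to\mathbf{B}Y$ defined by $\mathbf{B}h([A])=[h(A)]$ is a well-defined proximity map. Moreover, if $l:X\to Y$ is a coarse proximity map that is close to $h$, then $\mathbf{B}h=\mathbf{B}l$.
   Context: Here $\mathbb{N}=\{1,2,\dots\}$. Metric coarse proximity. For subsets $A,B$ of a metric space $(X,d)$ put $d(A,B)=\inf\{d(x,y)\mid x\in A, y\in B\}$, with $\inf\emptyset=\infty$. Write $A\,\mathbf{b}\,B$ if there exists $\epsilon<\infty$ such that for all bounded sets $D\subseteq X$, $d(A\setminus D,B\setminus D)<\epsilon$; $\bar{\mathbf{b}}$ denotes the negation of $\mathbf{b}$. Write $A\ll B$ if $A\,\bar{\mathbf{b}}\,(X\setminus B)$. Write $A\,\phi\,B$ if $A\,\mathbf{b}\,B'$ for every unbounded $B'\subseteq B$ and $A'\,\mathbf{b}\,B$ for every unbounded $A'\subseteq A$; $\phi$ is an equivalence relation on the power set of $X$ (for nonempty sets it is the relation of having finite Hausdorff distance). Maps. A function $f:X\to Y$ between metric spaces is a coarse proximity map if it sends bounded sets to bounded sets and $A\,\mathbf{b}\,B$ in $X$ implies $f(A)\,\mathbf{b}\,f(B)$ in $Y$. Two functions $f,g:X\to Y$ are close if $f(A)\,\phi\,g(A)$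 for all $A\subseteq X$. Proximities. A proximity on a set $Z$ is a relation $\delta$ on the power set of $Z$ such that for all $A,B,C\subseteq Z$ (with $\bar\delta$ the negation of $\delta$): (i) $A\delta B$ implies $B\delta A$; (ii) $(A\cup B)\delta C$ iff $A\delta C$ or $B\delta C$; (iii) $A\delta B$ implies $A,B\neq\emptyset$; (iv) $A\bar\delta B$ implies that there exists $E\subseteq Z$ with $A\bar\delta E$ and $(Z\setminus E)\bar\delta B$; (v) $A\cap B\neq\emptyset$ implies $A\delta B$. A function $f:(Z,\delta_1)\to(W,\delta_2)$ is a proximity map if $A\delta_1B$ implies $f(A)\delta_2f(B)$. A proximity $\delta_1$ is finer than $\delta_2$ (on the same set) if $A\delta_1B$ implies $A\delta_2B$. For a surjection $f$ from a proximity space $(Z,\delta)$ onto a set $W$, the quotient proximity on $W$ is the finest proximity on $W$ for which $f$ is a proximity map (it always exists). Proximity space at infinity. A sequence $f:\mathbb{N}\to\mathbb{R}$ is adequate if it is positive and $f(n)-f(n-1)>n+1$ for all $n>1$. For $A\subseteq X$, $x_0\in X$ and $f$ adequate, put $U_{x_0}(A,f)=A\cup\bigcup_{n\geq1}\big(\mathscr{B}(A,n)\setminus\mathscr{B}(x_0,f(n))\big)$, where $\mathscr{B}(x,r)$ is the open ball and $\mathscr{B}(A,r)=\bigcup_{x\in A}\mathscr{B}(x,r)$. Let $\mathcal{H}_\infty(X)$ be the set of unbounded subsets of $X$, with the proximity $\delta$ defined by: $\mathcal{A}\,\delta\,\mathcal{C}$ iff for every adequate $f$ there are $A\in\mathcal{A}$,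 $C\in\mathcal{C}$ with $A\ll U_{x_0}(C,f)$ and $C\ll U_{x_0}(A,f)$ (this proximity does not depend on the choice of $x_0$). Let $\mathbf{B}X$ be the set of $\phi$-equivalence classes $[A]$ of unbounded sets $A\subseteq X$, endowed with the quotient proximity $\boldsymbol{\delta}$ induced by the projection $\pi:(\mathcal{H}_\infty(X),\delta)\to\mathbf{B}X$, $A\mapsto[A]$. The pair $(\mathbf{B}X,\boldsymbol{\delta})$ is the proximity space at infinity of $X$. *)

(* Defs.v *)
From HB Require Import structures.
From mathcomp Require Import all_boot all_order all_algebra.
From mathcomp Require Import all_classical all_reals all_analysis.
From mathcomp Require Import lra.

Set Implicit Arguments.
Unset Strict Implicit.
Unset Printing Implicit Defensive.

Import Order.TTheory GRing.Theory Num.Theory.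

Local Open Scope classical_set_scope.
Local Open Scope ring_scope.

Section Proximity.
Context {Z W : Type}.

Record is_proximity (T : Type) (delta : set T -> set T -> Prop) : Prop := {
  proximity_sym : forall A B, delta A B -> delta B A;
  proximity_union : forall A B C,
    delta (A `|` B) C <-> delta A C \/ delta B C;
  proximity_nonempty : forall A B, delta A B -> A !=set0 /\ B !=set0;
  proximity_strong : forall A B, ~ delta A B ->
    exists E, ~ delta A E /\ ~ delta (~` E) B;
  proximity_meet : forall A B, A `&` B !=set0 -> delta A B
}.

Definition proximity_map (delta1 : set Z -> set Z -> Prop)
    (delta2 : set W -> set W -> Prop) (f : Z -> W) : Prop :=
  forall A B, delta1 A B -> delta2 (f @` A) (f @` B).

Definition finer_proximity (delta1 delta2 : set W -> set W -> Prop) : Prop :=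
  forall A B, delta1 A B -> delta2 A B.

Definition is_quotient_proximity (delta : set Z -> set Z -> Prop) (f : Z -> W)
    (delta' : set W -> set W -> Prop) : Prop :=
  [/\ is_proximity delta', proximity_map delta delta' f &
      forall delta'', is_proximity delta'' -> proximity_map delta delta'' f ->
        finer_proximity delta' delta''].

(* Complement of the finest proximity: the relation generated by the pairs
   that are far for some proximity making f a proximity map. *)
Inductive quotient_far (delta : set Z -> set Z -> Prop) (f : Z -> W) :
    set W -> set W -> Prop :=
| quotient_far_base delta' A B : is_proximity delta' ->
    proximity_map delta delta' f -> ~ delta' A B -> quotient_far delta f A B
| quotient_far_unionl A B C : quotient_far delta f A C ->
    quotient_far delta f B C -> quotient_far delta f (A `|` B) C
| quotient_far_unionr A B C : quotient_far delta f C A ->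
    quotient_far delta f C B -> quotient_far delta f C (A `|` B)
| quotient_far_sub A B A' B' : A `<=` A' -> B `<=` B' ->
    quotient_far delta f A' B' -> quotient_far delta f A B.

Lemma quotient_proximity_exists (delta : set Z -> set Z -> Prop) (f : Z -> W) :
  (forall A B, delta A B -> delta B A) ->
  (forall A B C, delta (A `|` B) C <-> delta A C \/ delta B C) ->
  (forall A B, delta A B -> A !=set0 /\ B !=set0) ->
  exists delta', is_quotient_proximity delta f delta'.
Proof.
move=> dsym dU dN0; set far := quotient_far delta f.
pose nonempties (A B : set W) := A !=set0 /\ B !=set0.
have nonemptiesP : is_proximity nonempties.
  split; rewrite /nonempties.
  - by move=> A B [].
  - move=> A B C; split.
      by move=> [[x [Ax|Bx]] C0]; [left|right]; split => //; exists x.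
    by move=> [] [[x Ax] C0]; split => //; exists x; [left|right].
  - by [].
  - move=> A B nAB; have [[x Ax]|/nonemptyPn A0] := pselect (A !=set0).
      exists set0; split; first by move=> [_ [? []]].
      by move=> [_ B0]; apply: nAB; split => //; exists x.
    exists setT; split; first by move=> []; rewrite A0 => -[? []].
    by rewrite setCT => -[[? []]].
  - by move=> A B [x [Ax Bx]]; split; exists x.
have nonempties_map : proximity_map delta nonempties f.
  by move=> A B /dN0 [[x Ax] [y By]]; split; [exists (f x)|exists (f y)];
    apply: imageP.
have farC A B : far A B -> far B A.
  elim=> [d A' B' dP df nd|A' B' C _ ? _ ?|A' B' C _ ? _ ?|A1 B1 A2 B2 sA sB _ ?].
  - by apply: (@quotient_far_base _ _ d) => // /(proximity_sym dP).
  - exact: quotient_far_unionr.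
  - exact: quotient_far_unionl.
  - exact: (quotient_far_sub sB sA).
have far_disj A B : far A B -> ~ (A `&` B !=set0).
  elim=> [d A' B' dP df nd|A' B' C _ h1 _ h2|A' B' C _ h1 _ h2|
          A1 B1 A2 B2 sA sB _ h].
  - by move/(proximity_meet dP).
  - by move=> [x [[a|b] c]]; [apply: h1|apply: h2]; exists x.
  - by move=> [x [c [a|b]]]; [apply: h1|apply: h2]; exists x.
  - by move=> [x [a b]]; apply: h; exists x; split; [apply: sA|apply: sB].
have far_strong A B : far A B -> exists E, far A E /\ far (~` E) B.
  elim=> [d A' B' dP df nd|A' B' C _ [E1 [a1 b1]] _ [E2 [a2 b2]]|
          A' B' C _ [E1 [a1 b1]] _ [E2 [a2 b2]]|A1 B1 A2 B2 sA sB _ [E [a b]]].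
  - have [E [a b]] := proximity_strong dP nd.
    by exists E; split; apply: (@quotient_far_base _ _ d).
  - exists (E1 `&` E2); split.
      apply: quotient_far_unionl.
        by apply: (quotient_far_sub _ _ a1) => // x [].
      by apply: (quotient_far_sub _ _ a2) => // x [].
    by rewrite setCI; apply: quotient_far_unionl.
  - exists (E1 `|` E2); split; first exact: quotient_far_unionr.
    rewrite setCU; apply: quotient_far_unionr.
      by apply: (quotient_far_sub _ _ b1) => // x [].
    by apply: (quotient_far_sub _ _ b2) => // x [].
  - by exists E; split; [apply: (quotient_far_sub sA _ a)
                        |apply: (quotient_far_sub _ sB b)].
have dUr A B C : delta C (A `|` B) -> delta C A \/ delta C B.
  by move=> /dsym /dU [] /dsym; [left|right].
have dS A B A' B' : A `<=` A' -> B `<=` B' -> delta A B -> delta A' B'.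
  move=> /setUidPr <- /setUidPr <- d; apply/dU; left; apply/dsym/dU; left.
  exact: dsym.
have far_preim U V : far U V -> ~ delta (f @^-1` U) (f @^-1` V).
  elim=> [d A' B' dP df nd|A' B' C _ h1 _ h2|A' B' C _ h1 _ h2|
          A1 B1 A2 B2 sA sB _ h].
  - move=> /df dAB; apply: nd.
    have dS' : forall A B C, A `<=` B -> d A C -> d B C.
      by move=> A B C /setUidPr <- h; apply/(proximity_union dP); left.
    apply: (dS' _ _ _ (@image_preimage_subset _ _ f A')).
    apply/(proximity_sym dP).
    apply: (dS' _ _ _ (@image_preimage_subset _ _ f B')).
    exact/(proximity_sym dP).
  - by rewrite preimage_setU => /dU [].
  - by rewrite preimage_setU => /dUr [].
  - by move=> d; apply: h; apply: dS d => x; [apply: sA|apply: sB].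
exists (fun A B => ~ far A B); split.
- split.
  + by move=> A B nf /farC.
  + move=> A B C; split.
      move=> nf; apply: contrapT => /not_orP [/contrapT a /contrapT b].
      by apply: nf; apply: quotient_far_unionl.
    by move=> [] nf h; apply: nf; apply: (quotient_far_sub _ _ h).
  + move=> A B nf; apply: contrapT => n; apply: nf.
    exact: (@quotient_far_base _ _ nonempties).
  + move=> A B /contrapT /far_strong [E [a b]].
    by exists E; split; apply.
  + by move=> A B AB /far_disj.
- move=> A B dAB /far_preim; apply.
  by apply: dS dAB; apply: preimage_image.
- move=> d dP df A B nf; apply: contrapT => n; apply: nf.
  exact: (@quotient_far_base _ _ d).
Qed.

End Proximity.

Section CoarseProximity.
Context {R : realType} {X : metricType R}.
Implicit Types (A B C D : set X) (f : nat -> R).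

Definition bounded A : Prop :=
  exists M : R, forall x y, A x -> A y -> mdist x y <= M.

Definition unbounded A : Prop := ~ bounded A.

Definition set_dist A B : \bar R :=
  ereal_inf [set (mdist p.1 p.2)%:E | p in A `*` B].

Definition coarse_near A B : Prop :=
  exists e : R, forall D, bounded D ->
    (set_dist (A `\` D) (B `\` D) < e%:E)%E.

Definition coarse_ll A B : Prop := ~ coarse_near A (~` B).

Definition coarse_phi A B : Prop :=
  (forall B', unbounded B' -> B' `<=` B -> coarse_near A B') /\
  (forall A', unbounded A' -> A' `<=` A -> coarse_near A' B).

(* The value f 0 is irrelevant: indices start at 1. *)
Definition adequate f : Prop :=
  (forall n, (1 <= n)%N -> 0 < f n) /\
  (forall n, (1 < n)%N -> n.+1%:R < f n - f n.-1).

Definition thickening A (r : R) : set X := \bigcup_(x in A) ball x r.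

Definition growing_nbhs (x0 : X) A f : set X :=
  A `|` \bigcup_(n in [set n | (1 <= n)%N])
          (thickening A n%:R `\` ball x0 (f n)).

Definition unbounded_sets : Type := {A : set X | unbounded A}.

Definition unbounded_sets_proximity (x0 : X)
    (calA calC : set unbounded_sets) : Prop :=
  forall f, adequate f -> exists A C : unbounded_sets, [/\ calA A, calC C,
    coarse_ll (sval A) (growing_nbhs x0 (sval C) f) &
    coarse_ll (sval C) (growing_nbhs x0 (sval A) f)].

Definition boundary : Type :=
  {c : set (set X) | exists A, unbounded A /\ c = [set B | coarse_phi A B]}.

Definition boundary_class (A : unbounded_sets) : boundary :=
  exist _ [set B | coarse_phi (sval A) B]
    (ex_intro _ (sval A) (conj (svalP A) erefl)).

Lemma coarse_nearS A B B' : B `<=` B' -> coarse_near A B -> coarse_near A B'.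
Proof.
move=> sB [e he]; exists e => D Db; apply: le_lt_trans (he _ Db).
apply: ereal_inf_le_tmp => _ [[x y] /= [Ax [By nDy]] <-].
by exists (x, y) => //; split => //; split => //; apply: sB.
Qed.

Lemma coarse_llS A B B' : B `<=` B' -> coarse_ll A B -> coarse_ll A B'.
Proof. by move=> sB nb /coarse_nearS b; apply/nb/b/subsetC. Qed.

Lemma growing_nbhsS (x0 : X) A f g : (forall n, f n <= g n) ->
  growing_nbhs x0 A g `<=` growing_nbhs x0 A f.
Proof.
move=> fg x [Ax|[n n1 [Anx xg]]]; [by left|right; exists n => //; split => //].
by move=> xf; apply: xg; apply: le_ball xf.
Qed.

Lemma infinity_proximity_exists (x0 : X) :
  exists delta, is_quotient_proximity (unbounded_sets_proximity x0)
                  boundary_class delta.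
Proof.
have dsym P Q : unbounded_sets_proximity x0 P Q ->
    unbounded_sets_proximity x0 Q P.
  by move=> h f /h [a [c [? ? ? ?]]]; exists c, a; split.
apply: quotient_proximity_exists => //.
- move=> P Q S; split; last first.
    by move=> [] h f /h [a [c [? ? ? ?]]]; exists a, c; split => //;
      [left|right].
  move=> h; apply: contrapT => /not_orP [].
  move=> /existsNP [f1 /not_implyP [af1 n1]].
  move=> /existsNP [f2 /not_implyP [af2 n2]].
  pose g n := Num.max (f1 n) (f2 n).
  have ag : adequate g.
    split=> [n n0|n n1']; first by rewrite lt_max af1.1.
    have := af1.2 _ n1'; have := af2.2 _ n1'; rewrite /g.
    by case: (lerP (f1 n)); case: (lerP (f1 n.-1)); lra.
  have g1 n : f1 n <= g n by rewrite le_max lexx.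
  have g2 n : f2 n <= g n by rewrite le_max lexx orbT.
  have [a [c [[Pa|Qa] Sc ac ca]]] := h g ag.
    apply: n1; exists a, c; split => //.
      exact: coarse_llS (growing_nbhsS g1) ac.
    exact: coarse_llS (growing_nbhsS g1) ca.
  apply: n2; exists a, c; split => //.
    exact: coarse_llS (growing_nbhsS g2) ac.
  exact: coarse_llS (growing_nbhsS g2) ca.
- have ad : adequate (fun n => (n.+1 ^ 2)%:R).
    split=> [n _|[//|n] _ /=]; first by rewrite ltr0n expn_gt0.
    have : 0 <= n%:R :> R by [].
    by rewrite !natrX -!natr1; nra.
  by move=> P Q /(_ _ ad) [a [c [Pa Qc _ _]]]; split; [exists a|exists c].
Qed.

(* The finest proximity is unique, so the choice made by cid is immaterial. *)
Definition infinity_proximity (x0 : X) : set boundary -> set boundary -> Prop :=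
  sval (cid (infinity_proximity_exists x0)).

End CoarseProximity.

Arguments unbounded_sets {R} X.
Arguments boundary {R} X.

Section Maps.
Context {R : realType} {X Y : metricType R}.
Implicit Types h l : X -> Y.

Definition coarse_proximity_map h : Prop :=
  (forall A, bounded A -> bounded (h @` A)) /\
  (forall A B, coarse_near A B -> coarse_near (h @` A) (h @` B)).

Definition close_maps h l : Prop := forall A, coarse_phi (h @` A) (l @` A).

Definition induced_map h (Bh : boundary X -> boundary Y) : Prop :=
  forall A : unbounded_sets X, exists hA : unbounded (h @` sval A),
    Bh (boundary_class A) = boundary_class (exist _ (h @` sval A) hA).

End Maps.

(* Main.v *)
Require Import Defs.
From mathcomp Require Import all_boot all_order all_algebra.
From mathcomp Require Import all_classical all_reals all_analysis.
From mathcomp Require Import lra.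

(** The proximity at infinity of X is the finest one making the projection
    A |-> [A] a proximity map. Pulling back the proximity at infinity of Y along
    Bh gives a proximity on BX, so it is enough that A |-> h(A) is a proximity
    map between the hyperspaces of unbounded sets. This holds because a coarse
    proximity map is proper and bornologous: for every adequate g there is an
    adequate f, growing fast enough in terms of the control function of h and of
    the preimages of balls, such that A << U(C, f) implies
    h(A) << U(h(C), g). *)

Set Implicit Arguments.
Unset Strict Implicit.
Unset Printing Implicit Defensive.

Import Order.TTheory GRing.Theory Num.Theory.

Local Open Scope classical_set_scope.
Local Open Scope ring_scope.

(** * Monotonicity and pullback of proximities *)

Section Proximities.
Context {Z W : Type}.

Lemma is_proximity_mono (d : set W -> set W -> Prop) A A' B B' :
  is_proximity d -> A `<=` A' -> B `<=` B' -> d A B -> d A' B'.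
Proof.
move=> dP /setUidPr <- /setUidPr <- AB.
apply/(proximity_union dP); left; apply/(proximity_sym dP).
by apply/(proximity_union dP); left; apply/(proximity_sym dP).
Qed.

Lemma is_proximity_pullback (f : Z -> W) (d : set W -> set W -> Prop) :
  is_proximity d -> is_proximity (fun A B => d (f @` A) (f @` B)).
Proof.
move=> dP; split.
- by move=> A B; apply: proximity_sym.
- by move=> A B C; rewrite image_setU; apply: proximity_union.
- move=> A B /(proximity_nonempty dP) [[_ [x Ax _]] [_ [y By _]]].
  by split; [exists x|exists y].
- move=> A B /(proximity_strong dP) [E [AE EB]].
  exists (f @^-1` E); split.
    by move=> n; apply: AE; apply: is_proximity_mono n => // _ [x Ex <-].
  by move=> n; apply: EB; apply: is_proximity_mono n => // _ [x Ex <-].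
- move=> A B [x [Ax Bx]]; apply: (proximity_meet dP).
  by exists (f x); split; apply: imageP.
Qed.

End Proximities.

Lemma exists_natr_gt (R : realType) (x : R) : exists n : nat, x < n%:R.
Proof.
exists (Num.bound `|x|); apply: le_lt_trans (ler_norm x) _.
exact: archi_boundP.
Qed.

(** * Coarse nearness, the relation [coarse_phi] and boundary classes *)

Section Coarse.
Context {R : realType} {X : metricType R} (x0 : X).
Implicit Types A B C : set X.

Lemma boundedP A :
  bounded A <-> exists n : nat, forall x, A x -> mdist x0 x < n%:R.
Proof.
split=> [[M AM]|[n An]].
  have [[a Aa]|/nonemptyPn ->] := pselect (A !=set0); last by exists 0%N.
  have [n nM] := exists_natr_gt (mdist x0 a + M); exists n => x Ax.
  apply: le_lt_trans nM; apply: le_trans (metric_triangle _ a _) _.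
  by rewrite lerD2l AM.
exists (n%:R + n%:R) => x y /An xn /An yn.
apply: le_trans (metric_triangle _ x0 _) _.
by rewrite metric_sym lerD // ltW.
Qed.

Lemma unboundedP A :
  unbounded A <-> forall n : nat, exists2 x, A x & n%:R <= mdist x0 x.
Proof.
split=> [uA n|uA /boundedP [n An]].
  apply: contrapT => nA; apply: uA; apply/boundedP; exists n => x Ax.
  by rewrite ltNge; apply/negP => nx; apply: nA; exists x.
by have [x /An] := uA n; rewrite ltNge => /negP.
Qed.

Lemma bounded_sub A B : A `<=` B -> bounded B -> bounded A.
Proof. by move=> AB [M BM]; exists M => x y /AB ? /AB; apply: BM. Qed.

(** Balls about [x0] are cofinal among bounded sets, and an infimum below a bound is witnessed by a
    pair of points. *)
Lemma coarse_nearP A B : coarse_near A B <->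
  exists r : nat, forall n : nat, exists a b,
    [/\ A a /\ B b, n%:R <= mdist x0 a, n%:R <= mdist x0 b
      & mdist a b < r%:R].
Proof.
split=> [[e he]|[r hr]].
  have [r er] := exists_natr_gt e; exists r => n.
  have /he : bounded [set x | mdist x0 x < n%:R] by apply/boundedP; exists n.
  case/ereal_inf_lt => _ [[a b] /= [[Aa /negP na] [Bb /negP nb]] <-].
  rewrite lte_fin => abe; exists a, b; split => //; rewrite ?leNgt //.
  exact: lt_trans er.
exists r%:R => D /boundedP [n Dn].
have [a [b [[Aa Bb] na nb abr]]] := hr n.
apply: (@le_lt_trans _ _ (mdist a b)%:E); last by rewrite lte_fin.
apply: ereal_inf_lbound; exists (a, b) => //.
by split; split => // /Dn; rewrite ltNge => /negP.
Qed.

Lemma coarse_near_sym A B : coarse_near A B -> coarse_near B A.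
Proof.
move=> /coarse_nearP [r hr]; apply/coarse_nearP; exists r => n.
have [a [b [[? ?] ? ? ?]]] := hr n.
by exists b, a; split; rewrite // metric_sym.
Qed.

Lemma coarse_near_unbounded A B : coarse_near A B -> unbounded A.
Proof.
move=> /coarse_nearP [r hr]; apply/unboundedP => n.
by have [a [b [[? ?] ? ? ?]]] := hr n; exists a.
Qed.

Lemma coarse_near_refl A : unbounded A -> coarse_near A A.
Proof.
move=> /unboundedP uA; apply/coarse_nearP; exists 1%N => n.
by have [a ? ?] := uA n; exists a, a; split; rewrite // mdistxx.
Qed.

Lemma coarse_phi_refl A : coarse_phi A A.
Proof.
by split=> A' uA' A'A; [apply: coarse_near_sym|];
  apply: (coarse_nearS A'A); apply: coarse_near_refl.
Qed.

Lemma coarse_phi_sym A B : coarse_phi A B -> coarse_phi B A.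
Proof.
by move=> [AB BA]; split=> C uC CB; apply: coarse_near_sym;
  [apply: BA|apply: AB].
Qed.

(* Apply the hypothesis to the set of points of [B] lying within bounded
   distance of [C]: it is unbounded as soon as [B] is near [C]. *)
Lemma coarse_near_trans A B C :
    (forall B', unbounded B' -> B' `<=` B -> coarse_near A B') ->
  coarse_near B C -> coarse_near A C.
Proof.
move=> AB /coarse_nearP [r BC].
pose B' := [set b | B b /\ exists2 c, C c & mdist b c < r%:R].
have uB' : unbounded B'.
  apply/unboundedP => n; have [b [c [[Bb Cc] nb nc bc]]] := BC n.
  by exists b => //; split => //; exists c.
have /coarse_nearP [s AB'] : coarse_near A B' by apply: AB => // b [].
apply/coarse_nearP; exists (s + r)%N => n.
(* The extra [r] is spent on moving from [b] to [c]. *)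
have [a [b [[Aa [Bb [c Cc bc]]] na nb ab]]] := AB' (n + r)%N.
exists a, c; move: na nb; rewrite !natrD => na nb; split => //.
- by apply: le_trans na; rewrite lerDl.
- by have := metric_triangle x0 c b; rewrite (metric_sym c); lra.
- by apply: le_lt_trans (metric_triangle _ b _) _; rewrite ltrD.
Qed.

Lemma coarse_phi_trans A B C :
  coarse_phi A B -> coarse_phi B C -> coarse_phi A C.
Proof.
move=> [AB BA] [BC CB]; split=> [C' uC' C'C|A' uA' A'A].
  exact: coarse_near_trans AB (BC _ uC' C'C).
apply/coarse_near_sym/(@coarse_near_trans _ B).
  by move=> B' uB' B'B; apply/coarse_near_sym/CB.
exact/coarse_near_sym/BA.
Qed.

Lemma boundary_class_eqP (A B : unbounded_sets X) :
  boundary_class A = boundary_class B <-> coarse_phi (sval A) (sval B).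
Proof.
split=> [[AB]|AB].
  suff : [set C | coarse_phi (sval A) C] (sval B) by [].
  by rewrite AB; apply: coarse_phi_refl.
apply: eq_exist; apply/seteqP; split=> C /=.
  exact/coarse_phi_trans/coarse_phi_sym.
exact: coarse_phi_trans.
Qed.

(** An unbounded difference would be near itself, which makes [A] near the complement of [B]. *)
Lemma coarse_ll_bounded A B : coarse_ll A B -> bounded (A `\` B).
Proof.
move=> AB; apply: contrapT => /coarse_near_refl n; apply: AB.
apply: (@coarse_nearS _ _ _ (A `\` B)) => [x []//|].
by apply/coarse_near_sym/(coarse_nearS _ (coarse_near_sym n)) => x [].
Qed.

Lemma boundary_class_surj (c : boundary X) :
  exists A : unbounded_sets X, boundary_class A = c.
Proof.
case: c => c [A [uA cA]]; exists (exist _ A uA); exact: eq_exist.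
Qed.

End Coarse.

(** * Adequate functions of arbitrarily fast growth *)

Lemma adequate_dominating (R : realType) (b : nat -> R) :
  exists2 f : nat -> R, adequate f & forall n, b n <= f n.
Proof.
(* The last summand dominates [b n], and its part [n + 2] makes the increment exceed [n + 1]. *)
pose f n := \sum_(i < n.+1) (`|b i| + i%:R + 2).
have fS n : f n.+1 = f n + (`|b n.+1| + n.+1%:R + 2) by rewrite /f big_ord_recr.
have f_ge0 n : 0 <= f n by apply: sumr_ge0 => i _; rewrite !addr_ge0.
exists f.
  split=> [n _|[//|n] _ /=].
    rewrite /f big_ord_recr /= ltr_wpDl ?ltr_wpDl ?addr_ge0 //.
    by apply: sumr_ge0 => i _; rewrite !addr_ge0.
  rewrite fS addrAC subrr add0r -[n.+2%:R]natr1.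
  by have := normr_ge0 (b n.+1); lra.
case=> [|n].
  by rewrite /f big_ord1 addr0; have := ler_norm (b 0%N); lra.
rewrite fS; have := ler_norm (b n.+1); have := f_ge0 n.
by have : 0 <= n.+1%:R :> R by []; lra.
Qed.

(** * Coarse proximity maps: properness, control, effect on [coarse_ll] *)

Section CoarseMaps.
Context {R : realType} {X Y : metricType R} (x0 : X) (y0 : Y).

Section OneMap.
Context (h : X -> Y) (hh : coarse_proximity_map h).

(** Unboundedness amounts to being near oneself, which [h] preserves. *)
Lemma coarse_map_unbounded A : unbounded A -> unbounded (h @` A).
Proof.
by move=> /(coarse_near_refl x0)/hh.2; apply: coarse_near_unbounded.
Qed.

Lemma coarse_map_proper B : bounded B -> bounded (h @^-1` B).
Proof.
move=> bB; apply: contrapT => /coarse_map_unbounded; apply.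
by apply: bounded_sub bB => _ [x Bx <-].
Qed.

Lemma coarse_map_phi A B : coarse_phi A B -> coarse_phi (h @` A) (h @` B).
Proof.
(* The part of [D] mapped into [D'] is unbounded, since its image covers [D'] and [h] preserves
   boundedness; so it is near [C], and [h] carries this nearness over. *)
have half C D : (forall D', unbounded D' -> D' `<=` D -> coarse_near C D') ->
    forall D', unbounded D' -> D' `<=` h @` D -> coarse_near (h @` C) D'.
  move=> CD D' uD' D'D.
  have nC : coarse_near C (D `&` h @^-1` D').
    apply: CD => [/hh.1 b|x []//]; apply: uD'; apply: bounded_sub b => y D'y.
    by have [x Dx xy] := D'D _ D'y; exists x => //; split => //=; rewrite xy.
  by apply: coarse_nearS (hh.2 _ _ nC) => _ [x [_ D'x] <-].
move=> [AB BA]; split; first exact: half.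
move=> A' uA' A'A; apply: (coarse_near_sym y0).
apply: half uA' A'A => C uC CA; apply: (coarse_near_sym x0); exact: BA.
Qed.

(* If pairs at distance below [r] had images arbitrarily far apart, a sparse
   choice of such pairs would give near sets with images that are not near. *)
Lemma coarse_map_bornologous (r : nat) : exists s : nat, forall x y,
  mdist x y < r%:R -> mdist (h x) (h y) < s%:R.
Proof.
apply: contrapT => nob.
have far (T : nat) : exists p : X * X,
    mdist p.1 p.2 < r%:R /\ T%:R <= mdist (h p.1) (h p.2).
  apply: contrapT => nT; apply: nob; exists T => x y xy.
  by rewrite ltNge; apply/negP => Tn; apply: nT; exists (x, y).
(* If one image had norm below [n], properness would put its point within [m] of [x0], hence both
   points within [m + r], and the images would be less than [T + T] apart; a pair with images at
   least [n + T + T] apart excludes this. *)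
have escape (n : nat) : exists p : X * X, [/\ mdist p.1 p.2 < r%:R,
    n%:R <= mdist (h p.1) (h p.2), n%:R <= mdist y0 (h p.1)
    & n%:R <= mdist y0 (h p.2)].
  have /coarse_map_proper/(boundedP x0) [m hm] :
      bounded [set y | mdist y0 y < n%:R].
    by apply/(boundedP y0); exists n.
  have /hh.1/(boundedP y0) [T hT] : bounded [set x | mdist x0 x < (m + r)%:R].
    by apply/(boundedP x0); exists (m + r)%N.
  have [[x y] /= [xy Txy]] := far (n + T + T)%N; exists (x, y) => /=.
  have close u v : mdist u v < r%:R ->
      mdist y0 (h u) < n%:R -> mdist (h u) (h v) < T%:R + T%:R.
    move=> uv /hm um.
    have /hT : (h @` [set x | mdist x0 x < (m + r)%:R]) (h u).
      by apply: imageP => /=; apply: lt_le_trans um _; rewrite ler_nat leq_addr.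
    have /hT : (h @` [set x | mdist x0 x < (m + r)%:R]) (h v).
      apply: imageP => /=; rewrite natrD.
      by apply: le_lt_trans (metric_triangle _ u _) _; rewrite ltrD.
    by have := metric_triangle (h u) y0 (h v); rewrite (metric_sym _ y0); lra.
  move: Txy; rewrite !natrD => Txy; have n0 : 0 <= n%:R :> R by [].
  have T0 : 0 <= T%:R :> R by [].
  split => //; first by lra.
    by rewrite leNgt; apply/negP => /(close _ _ xy); lra.
  rewrite leNgt; apply/negP => yn; rewrite (metric_sym x) in xy.
  by have := close _ _ xy yn; rewrite metric_sym; lra.
have [p hp] := choice escape.
have norm_bound n : exists k : nat,
    mdist y0 (h (p n).1) < k%:R /\ mdist y0 (h (p n).2) < k%:R.
  have [i hi] := exists_natr_gt (mdist y0 (h (p n).1)).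
  have [j hj] := exists_natr_gt (mdist y0 (h (p n).2)).
  exists (i + j)%N; rewrite natrD.
  by split; [rewrite ltr_wpDr|rewrite ltr_wpDl].
have [k hk] := choice norm_bound.
(* The next index exceeds the norms of both current images by more than the current index. *)
pose N := fix N j := if j is i.+1 then (N i + k (N i)).+1 else 0%N.
have NS i : N i.+1 = (N i + k (N i)).+1 by [].
have N_mono : {homo N : i j / (i <= j)%N}.
  by apply: homo_leq leqnn leq_trans _ => i; rewrite NS leqW // leq_addr.
have N_ge i : (i <= N i)%N.
  by elim: i => // i IH; rewrite NS ltnS (leq_trans IH) // leq_addr.
pose u i := h (p (N i)).1; pose v i := h (p (N i)).2.
have uN i : (N i)%:R <= mdist y0 (u i) by have [] := hp (N i).
have vN i : (N i)%:R <= mdist y0 (v i) by have [] := hp (N i).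
have uS i : mdist y0 (u i) + (N i)%:R < (N i.+1)%:R.
  have [+ _] := hk (N i); rewrite NS -natr1 natrD -/(u i).
  by have : 0 <= 1 :> R by []; lra.
have vS i : mdist y0 (v i) + (N i)%:R < (N i.+1)%:R.
  have [_] := hk (N i); rewrite NS -natr1 natrD -/(v i).
  by have : 0 <= 1 :> R by []; lra.
(* Off the diagonal the difference of norms gives the bound; on it, the choice of [p] does. *)
have sparse i j : (minn (N i) (N j))%:R <= mdist (u i) (v j).
  have gap (a b : Y) : mdist y0 b <= mdist y0 a + mdist a b.
    exact: metric_triangle.
  case: (ltngtP i j) => [ij|ji|<-].
  - rewrite (minn_idPl (N_mono _ _ (ltnW ij))).
    have := N_mono _ _ ij; rewrite -(ler_nat R) => ijN.
    by have := gap (u i) (v j); have := uS i; have := vN j; lra.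
  - rewrite (minn_idPr (N_mono _ _ (ltnW ji))).
    have := N_mono _ _ ji; rewrite -(ler_nat R) => jiN.
    by have := gap (v j) (u i); rewrite (metric_sym (v j));
      have := vS j; have := uN i; lra.
  - by rewrite minnn; have [] := hp (N i).
have : coarse_near (range (fun i => (p (N i)).1))
                   (range (fun i => (p (N i)).2)).
  apply/(coarse_nearP x0); exists r => n.
  have /hh.1/(boundedP y0) [m hm] : bounded [set x | mdist x0 x < n%:R].
    by apply/(boundedP x0); exists n.
  (* The pairs themselves go to infinity because their images do. *)
  have far_out x : m%:R <= mdist y0 (h x) -> n%:R <= mdist x0 x.
    move=> mx; rewrite leNgt; apply/negP => xn.
    by have := hm (h x) (ex_intro2 _ _ x xn erefl); lra.
  have mN : m%:R <= (N m)%:R :> R by rewrite ler_nat.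
  exists (p (N m)).1, (p (N m)).2; split.
  - by split; exists m.
  - by apply: far_out; apply: le_trans (uN m).
  - by apply: far_out; apply: le_trans (vN m).
  - by have [] := hp (N m).
move=> /hh.2 /(coarse_nearP y0) [s hs].
have [_ [_ [[[_ [i _ <-] <-] [_ [j _ <-] <-]]]]] := hs (N s.+1).
rewrite -/(u i) -/(v j) => Nu Nv; apply/negP; rewrite -leNgt.
apply: le_trans (sparse i j); rewrite ler_nat leq_min.
(* Images of such large norm have index at least [s], so [sparse] keeps them at least [s] apart,
   against nearness with constant [s]. *)
have late w : (N s.+1)%:R <= mdist y0 (w : Y) -> forall i,
    mdist y0 w + (N i)%:R < (N i.+1)%:R -> (s <= N i)%N.
  move=> Nw l wl; apply: leq_trans (N_ge l); rewrite leqNgt; apply/negP => ls.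
  have : (N l.+1 <= N s.+1)%N by apply/N_mono/ltnW.
  by rewrite -(ler_nat R); have : 0 <= (N l)%:R :> R by []; lra.
by rewrite (late _ Nu i (uS i)) (late _ Nv j (vS j)).
Qed.

Lemma coarse_map_ll (g : nat -> R) : adequate g ->
  exists2 f, adequate f & forall A C, coarse_ll A (growing_nbhs x0 C f) ->
    coarse_ll (h @` A) (growing_nbhs y0 (h @` C) g).
Proof.
move=> ag; have [rho hrho] := choice coarse_map_bornologous.
(* A point within [e] of [h a], with [a] within [n] of [C], is within
   [rho n + e] of [h C]. As [e] is unknown when [f] is chosen, [m n] works only
   for [n >= e]; a smaller [n] is replaced by [e.+1], since far-away points
   satisfy the lower bound [f e.+1] as well. *)
pose m n := (rho n + n)%N.
(* The slack [n] in the radius absorbs the step from [h a] to a point within [e <= n] of it. *)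
have preimage_bound n : exists b : nat, forall x,
    mdist y0 (h x) < g (m n) + n%:R -> mdist x0 x < b%:R.
  apply/(boundedP x0).
  apply: (@coarse_map_proper [set y | mdist y0 y < g (m n) + n%:R]).
  have [t ht] := exists_natr_gt (g (m n) + n%:R).
  by apply/(boundedP y0); exists t => y yt; apply: lt_trans ht.
have [b hb] := choice preimage_bound.
have [f af fb] := adequate_dominating (fun n => (b n)%:R : R).
exists f => // A C /(coarse_ll_bounded x0) /(boundedP x0) [t ht].
move=> /(coarse_nearP y0) [e he].
have [w hw] := exists_natr_gt (f e.+1).
have /hh.1/(boundedP y0) [q hq] : bounded [set x | mdist x0 x < (t + w)%:R].
  by apply/(boundedP x0); exists (t + w)%N.
have [z hz] := exists_natr_gt (g e.+1).
(* Norm at least [q] for [h a] forces norm at least [t + w] for [a]: [t] places [a] in the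
   neighbourhood of [C], [w] takes it beyond [f e.+1]. The term [z] takes [y] beyond [g e.+1], for
   the case of [a] in [C]. *)
have [_ [y [[[a Aa <-] ny] na yz ay]]] := he (q + z)%N.
apply: ny.
have a_far : (t + w)%:R <= mdist x0 a.
  rewrite leNgt; apply/negP => aw.
  have := hq _ (ex_intro2 _ _ a aw erefl); move: na; rewrite natrD.
  by have : 0 <= z%:R :> R by []; lra.
have y_in n c : C c -> mdist (h a) (h c) < (rho n)%:R ->
    (e <= n)%N -> (0 < n)%N -> g (m n) <= mdist y0 y ->
    growing_nbhs y0 (h @` C) g y.
  move=> Cc ac en n0 gy; right; exists (m n) => /=.
    by rewrite /m addn_gt0 n0 orbT.
  split; last by rewrite ballEmdist /=; apply/negP; rewrite -leNgt.
  exists (h c); first exact: imageP.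
  rewrite ballEmdist /= metric_sym /m natrD addrC.
  apply: le_lt_trans (metric_triangle _ (h a) _) _.
  rewrite ltrD // metric_sym; apply: lt_le_trans ay _.
  by rewrite ler_nat.
have /contrapT [Ca|[n n1 [[c Cc]]]] : ~ ~ growing_nbhs x0 C f a.
- move=> nU; have := ht a (conj Aa nU); move: a_far; rewrite natrD.
  by have : 0 <= w%:R :> R by []; lra.
- right; exists e.+1 => //; split.
    exists (h a); first exact: imageP.
    rewrite ballEmdist /=; apply: lt_trans ay _.
    by rewrite ltr_nat.
  rewrite ballEmdist /=; apply/negP; rewrite -leNgt; apply: ltW.
  by apply: lt_le_trans hz _; apply: le_trans yz; rewrite ler_nat leq_addl.
- rewrite !ballEmdist /= => ca /negP; rewrite -leNgt => fa.
  have radius_far l : (e <= l)%N -> f l <= mdist x0 a ->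
      g (m l) <= mdist y0 y.
    move=> el fl; have : g (m l) + l%:R <= mdist y0 (h a).
      rewrite leNgt; apply/negP => /hb; have := fb l; lra.
    have := metric_triangle y0 y (h a); rewrite (metric_sym y).
    by have : e%:R <= l%:R :> R by [rewrite ler_nat]; lra.
  rewrite metric_sym in ca.
  case: (leqP e n) => en.
    by apply: (y_in n c) => //; [apply: hrho|apply: radius_far].
  apply: (y_in e.+1 c) => //.
    by apply: hrho; apply: lt_trans ca _; rewrite ltr_nat ltnW.
  apply: radius_far => //; apply/ltW/(lt_le_trans hw)/(le_trans _ a_far).
  by rewrite ler_nat leq_addl.
Qed.

(** * The induced maps on hyperspaces and at infinity *)

Definition image_unbounded (A : unbounded_sets X) : unbounded_sets Y :=
  exist _ (h @` sval A) (coarse_map_unbounded (svalP A)).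

Lemma image_unbounded_proximity_map :
  proximity_map (unbounded_sets_proximity x0) (unbounded_sets_proximity y0)
    image_unbounded.
Proof.
move=> P Q PQ g ag; have [f af fP] := coarse_map_ll ag.
have [A [C [PA QC AC CA]]] := PQ f af.
exists (image_unbounded A), (image_unbounded C).
by split; [apply: imageP|apply: imageP|apply: fP|apply: fP].
Qed.

(** By proof irrelevance, the proof that the image is unbounded can be fixed once and for all. *)
Lemma induced_mapP Bh : induced_map h Bh <->
  forall A, Bh (boundary_class A) = boundary_class (image_unbounded A).
Proof.
split=> [BhP A|BhP A].
  have [hA ->] := BhP A; congr boundary_class; exact: eq_exist.
by exists (coarse_map_unbounded (svalP A)); apply: BhP.
Qed.

(** Representatives are chosen by [r]; independence of this choice is [coarse_map_phi]. *)
Lemma induced_map_exists : exists Bh, induced_map h Bh.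
Proof.
have [r hr] := choice (@boundary_class_surj R X).
exists (boundary_class \o image_unbounded \o r); apply/induced_mapP => A /=.
by apply/(boundary_class_eqP y0)/coarse_map_phi/(boundary_class_eqP x0)/hr.
Qed.

Lemma induced_map_unique Bh Bh' :
  induced_map h Bh -> induced_map h Bh' -> Bh = Bh'.
Proof.
move=> /induced_mapP BhP /induced_mapP Bh'P; apply/funext => c.
by have [A <-] := boundary_class_surj c; rewrite BhP Bh'P.
Qed.

(* The pullback along [Bh] of the proximity at infinity of [Y] makes the
   projection of [X] a proximity map, so the quotient proximity is finer. *)
Lemma induced_map_proximity_map Bh : induced_map h Bh ->
  proximity_map (infinity_proximity x0) (infinity_proximity y0) Bh.
Proof.
move=> /induced_mapP BhP; rewrite /infinity_proximity.
case: cid => d0 /= [_ _ d0_finest]; case: cid => d1 /= [d1P d1_proj _].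
apply: (d0_finest _ (is_proximity_pullback Bh d1P)) => P Q PQ.
have img S : Bh @` (boundary_class @` S) =
    boundary_class @` (image_unbounded @` S).
  by rewrite !image_comp; congr image; apply/funext => A /=; exact: BhP.
by rewrite !img; apply/d1_proj/image_unbounded_proximity_map.
Qed.

End OneMap.

Lemma induced_map_close (h l : X -> Y) Bh Bl :
  coarse_proximity_map h -> coarse_proximity_map l -> close_maps l h ->
  induced_map h Bh -> induced_map l Bl -> Bh = Bl.
Proof.
move=> hh hl lh /(induced_mapP hh) BhP /(induced_mapP hl) BlP.
apply/funext => c; have [A <-] := boundary_class_surj c; rewrite BhP BlP.
exact/(boundary_class_eqP y0)/(coarse_phi_sym y0)/lh.
Qed.

End CoarseMaps.

Theorem theorem8p23 (R : realType) (X Y : metricType R)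
    (hX : unbounded [set: X]) (hY : unbounded [set: Y])
    (x0 : X) (y0 : Y) (h : X -> Y) (hh : coarse_proximity_map h) :
  (exists! Bh : boundary X -> boundary Y, induced_map h Bh) /\
  (forall Bh : boundary X -> boundary Y, induced_map h Bh ->
     proximity_map (infinity_proximity x0) (infinity_proximity y0) Bh) /\
  (forall l : X -> Y, coarse_proximity_map l -> close_maps l h ->
     exists2 Bl : boundary X -> boundary Y, induced_map l Bl &
       forall Bh : boundary X -> boundary Y, induced_map h Bh -> Bh = Bl).
Proof.
split; [|split].
- have [Bh BhP] := induced_map_exists x0 y0 hh; exists Bh; split => // Bh'.
  exact: (induced_map_unique x0 y0 hh).
- exact: induced_map_proximity_map.
- move=> l hl lh; have [Bl BlP] := induced_map_exists x0 y0 hl.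
  exists Bl => // Bh BhP; exact: (induced_map_close x0 y0 hh hl lh).
Qed.
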